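(* For every graph $G$ and every positive integer $k$, \[ \left\lceil \frac{\mathrm{CL}(G)}{k} \right\rceil \leq b_k(G). \]
   Context: All graphs are finite, simple and undirected. Cooling number: initially all vertices of $G$ are uncooled. In each round, first every uncooled vertex with a cooled neighbor becomes cooled, then one uncooled vertex (if any remains) is chosen and cooled. $\mathrm{CL}(G)$ is the maximum, over all choices, of the number of rounds until all vertices are cooled (the round in which the last vertex becomes cooled is counted). $k$-liminal burning game on $G$ ($k$ a positive integer): two players, Saboteur and Arsonist. Each vertex is burned or unburned, and revealed or unrevealed; initially all are unburned and unrevealed. In each round: (i) propagation: every unburned vertex with a neighbor burned in an earlier round becomes burned (whether revealed or not); (ii) the Saboteur reveals $k$ vertices that are unrevealed and unburned (all such vertices if fewer than $k$ exist); revealed vertices stay revealed; (iii) the Arsonist burns one revealed unburned vertex (revealed in this or any earlier round), if one exists. The game ends in the round in which all vertices are burned. The Saboteur maximizes and the Arsonist minimizes the number of rounds; $b_k(G)$ is the number of rounds under optimal play. *)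

(* Defs.v *)
From mathcomp Require Import all_boot.

Set Implicit Arguments.
Unset Strict Implicit.
Unset Printing Implicit Defensive.

(* A graph is a symmetric irreflexive relation [e] on a finite
   type [T]; a set of vertices records which vertices are cooled, burned or
   revealed. *)

Section Processes.
Variables (T : finType) (e : rel T).
Implicit Types (A B C D R S : {set T}) (p : seq {set T}).

Definition spread B : {set T} := B :|: [set v | [exists u in B, e u v]].

(* Possible results of selecting one vertex of [A] and adding it to [B]; [B]
   is left unchanged when there is nothing to select. *)
Definition select_one A B : {set {set T}} :=
  if A == set0 then [set B] else [set v |: B | v in A].

(* The condition [C != setT] makes the process stop as soon as all vertices
   are cooled, so the length of a path from [set0] to [setT] is the index of
   the round in which the last vertex becomes cooled. *)
Definition cool_step : rel {set T} := fun C D =>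
  (C != setT) && (D \in select_one (~: spread C) (spread C)).

Definition full_cooling p := path cool_step set0 p && (last set0 p == setT).

(* [n <= #|T|] excludes no process: see [cooling_number_max]. *)
Definition cooling_number : nat :=
  \max_(n < #|T|.+1 | [exists p : n.-tuple {set T}, full_cooling p]) n.

(* [B] is the set of burned vertices after propagation. *)
Definition legal_reveal k B R S :=
  (S \subset ~: (R :|: B)) && (#|S| == minn k #|~: (R :|: B)|).

(* Minimax value of the position with burned set [B] and revealed set [R] at
   the start of a round, for the game cut after [n] rounds. The default
   [#|T|] never lowers the minimum, which ranges over a nonempty set: values
   are at most [n], and only [n <= #|T|] is used. *)
Fixpoint capped_rounds k n B R : nat :=
  if n is n'.+1 then
    if B == setT then 0 else
    (\max_(S : {set T} | legal_reveal k (spread B) R S)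
       \big[minn/#|T|]_(D in select_one ((R :|: S) :\: spread B) (spread B))
          capped_rounds k n' D (R :|: S)).+1
  else 0.

(* For [0 < k] every round burns at least one vertex, so the cut after
   [#|~: B|] rounds is never felt: [rounds_left_eq0] and [rounds_left_leq]
   characterize the value without cut. *)
Definition rounds_left k B R : nat := capped_rounds k #|~: B| B R.

Definition liminal_burning_number k : nat := rounds_left k set0 set0.

Lemma select_one_neq0 A B : select_one A B != set0.
Proof.
rewrite /select_one; case: ifPn => [_|/set0Pn[v vA]]; apply/set0Pn.
  by exists B; rewrite inE.
by exists (v |: B); apply/imsetP; exists v.
Qed.

Lemma select_one_shrinks A B D :
    B != setT -> A \subset ~: spread B ->
    (~: spread B != set0 -> A != set0) ->
  D \in select_one A (spread B) -> #|~: D| < #|~: B|.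
Proof.
move=> BT /subsetP sA A0 DA; apply: proper_card.
suff: (B \proper D) by rewrite properC.
have sBB: B \subset spread B by apply: subsetUl.
move: DA; rewrite /select_one; case: ifPn => [/eqP A_0|A_0].
  rewrite inE => /eqP ->.
  have /eqP sBT: ~: spread B == set0 by apply: contraT => /A0; rewrite A_0 eqxx.
  by rewrite -[spread B]setCK sBT setC0 properT.
case/imsetP=> v /sA; rewrite inE => vB ->; apply/properP; split.
  by apply: subset_trans sBB _; apply: subsetUr.
by exists v; [rewrite !inE eqxx | apply: contraNN vB => /(subsetP sBB)].
Qed.

Lemma cool_step_shrinks C D : cool_step C D -> #|~: D| < #|~: C|.
Proof. by case/andP=> CT; apply: select_one_shrinks. Qed.

Lemma cool_path_size C p : path cool_step C p -> size p <= #|~: C|.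
Proof.
elim: p C => //= D p IHp C /andP[/cool_step_shrinks CD /IHp].
by move/leq_ltn_trans; apply.
Qed.

Lemma full_cooling_exists : exists p, full_cooling p.
Proof.
suff [p]: exists p, path cool_step set0 p && (last set0 p == setT) by exists p.
have [n] := ubnP #|~: (set0 : {set T})|; elim: n (set0) => // n IHn C lt_n.
have [->|CT] := eqVneq C setT; first by exists [::]; rewrite /= eqxx.
have /set0Pn[D DC] := select_one_neq0 (~: spread C) (spread C).
have st: cool_step C D by rewrite /cool_step CT.
have [p pP] := IHn D (leq_trans (cool_step_shrinks st) lt_n).
by exists (D :: p); rewrite /= st.
Qed.

Lemma cooling_number_max :
  (exists2 p, full_cooling p & size p = cooling_number) /\
  (forall p, full_cooling p -> size p <= cooling_number).
Proof.
have size_lt p : full_cooling p -> size p < #|T|.+1.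
  by case/andP=> /cool_path_size; rewrite setC0 cardsT.
split=> [|p pP]; last first.
  apply: (bigmax_sup (Ordinal (size_lt p pP))) => //.
  by apply/existsP; exists (in_tuple p).
have [p pP] := full_cooling_exists.
pose Q (n : 'I_#|T|.+1) := [exists q : n.-tuple {set T}, full_cooling q].
have Qp : 0 < #|Q|.
  apply/card_gt0P; exists (Ordinal (size_lt p pP)).
  by apply/existsP; exists (in_tuple p).
have [i /existsP[q qP] iE] := eq_bigmax_cond (fun n => nat_of_ord n) Qp.
by exists (q : seq _); rewrite // size_tuple /cooling_number -iE.
Qed.

Lemma legal_reveal_exists k B R : exists S, legal_reveal k B R S.
Proof.
have [S] : exists S, S \in [set S : {set T} |
    (S \subset ~: (R :|: B)) & (#|S| == minn k #|~: (R :|: B)|)].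
  apply/set0Pn; rewrite -card_gt0 cards_draws bin_gt0; exact: geq_minr.
by rewrite inE; exists S.
Qed.

Lemma burn_shrinks k B R S D :
    0 < k -> B != setT -> legal_reveal k (spread B) R S ->
    D \in select_one ((R :|: S) :\: spread B) (spread B) ->
  #|~: D| < #|~: B|.
Proof.
move=> k0 BT /andP[sS /eqP cS]; apply: select_one_shrinks => //.
  by rewrite setDE subsetIr.
case/set0Pn=> v; rewrite in_setC => vB.
have [vR|vR] := boolP (v \in R).
  by apply/set0Pn; exists v; rewrite in_setD vB in_setU vR.
have: 0 < #|S|.
  rewrite cS leq_min k0; apply/card_gt0P; exists v.
  by rewrite in_setC in_setU negb_or vR.
case/card_gt0P=> w wS; apply/set0Pn; exists w.
move/subsetP/(_ w wS): sS; rewrite !in_setC in_setU negb_or => /andP[_ wB].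
by rewrite in_setD wB in_setU wS orbT.
Qed.

Lemma bigminn_leq (I : finType) (P : pred I) (F : I -> nat) x i :
  P i -> \big[minn/x]_(j | P j) F j <= F i.
Proof.
move=> Pi; elim: (index_enum I) (mem_index_enum i) => // j r IHr.
rewrite big_cons inE => /orP[/eqP <-|/IHr le_r]; first by rewrite Pi geq_minl.
by case: ifP => // _; apply: leq_trans (geq_minr _ _) le_r.
Qed.

Lemma capped_rounds_leq k n B R : capped_rounds k n B R <= n.
Proof.
elim: n B R => //= n IHn B R; case: ifP => // _; rewrite ltnS.
apply/bigmax_leqP => S _.
have /set0Pn[D DP] :=
  select_one_neq0 ((R :|: S) :\: spread B) (spread B).
apply: leq_trans (IHn D (R :|: S)).
exact: (bigminn_leq (fun D => capped_rounds k n D (R :|: S)) _ DP).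
Qed.

Lemma capped_rounds_stable k n B R :
  0 < k -> #|~: B| <= n -> capped_rounds k n B R = rounds_left k B R.
Proof.
move=> k0; rewrite /rounds_left => Bn.
have cut0 C : #|~: C| <= 0 -> C = setT.
  by rewrite leqn0 cards_eq0 => /eqP C0; rewrite -[C]setCK C0 setC0.
suff gen m : #|~: B| <= m -> capped_rounds k n B R = capped_rounds k m B R.
  exact: gen.
elim: n m B R Bn => [|n IHn] [|m] B R Bn Bm //=.
- by rewrite (cut0 B Bn) eqxx.
- by rewrite (cut0 B Bm) eqxx.
case: ifPn => // BT; congr _.+1.
apply: eq_bigr => S SP; apply: eq_bigr => D DP.
have lt_D := burn_shrinks k0 BT SP DP.
by apply: IHn; rewrite -ltnS (leq_trans lt_D).
Qed.

Lemma rounds_left_eq0 k B R : (rounds_left k B R == 0) = (B == setT).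
Proof.
rewrite /rounds_left; case cB: #|~: B| => [|n] /=; last by case: ifP.
by move/eqP: cB; rewrite cards_eq0 => /eqP B0; rewrite -[B]setCK B0 setC0 !eqxx.
Qed.

Lemma rounds_left_leq k B R m : 0 < k -> B != setT ->
  (rounds_left k B R <= m.+1) =
  [forall (S : {set T} | legal_reveal k (spread B) R S),
   exists D in select_one ((R :|: S) :\: spread B) (spread B),
     rounds_left k D (R :|: S) <= m].
Proof.
move=> k0 BT; rewrite -(capped_rounds_stable (n := #|~: B|.+1)) //=.
rewrite (negPf BT) ltnS.
have eqr S D : legal_reveal k (spread B) R S ->
    D \in select_one ((R :|: S) :\: spread B) (spread B) ->
  capped_rounds k #|~: B| D (R :|: S) = rounds_left k D (R :|: S).
  by move=> SP DP; rewrite capped_rounds_stable // ltnW //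
    (burn_shrinks k0 BT SP DP).
apply/bigmax_leqP/'forall_implyP => le_m S SP; last first.
  have /'exists_andP[D [DP Dm]] := le_m S SP.
  by apply: leq_trans (bigminn_leq _ _ DP) _; rewrite (eqr S).
apply/'exists_andP; have /set0Pn[D0 D0P] :=
  select_one_neq0 ((R :|: S) :\: spread B) (spread B).
move: (le_m S SP); elim/big_rec: _ => [Tm|D x DP IH].
  exists D0; split=> //; apply: leq_trans Tm.
  by apply: leq_trans (capped_rounds_leq _ _ _ _) (max_card _).
by rewrite geq_min (eqr S) // => /orP[Dm|/IH //]; exists D.
Qed.

End Processes.

(* Main.v *)
(* Fix a longest cooling sequence, with sets of cooled vertices C_0, C_1, ...
   In round r + 1 the Saboteur reveals the k vertices chosen in the cooling
   rounds kr + 1, ..., kr + k.  By induction all vertices burned or revealed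
   after r rounds lie in C_(kr), so these k vertices are unburned and
   unrevealed, and the graph cannot be fully burned before round CL(G) / k. *)
Require Import Defs.
From mathcomp Require Import all_boot all_order all_algebra.

Set Implicit Arguments.
Unset Strict Implicit.
Unset Printing Implicit Defensive.

Section CoolingBoundsBurning.
Variables (T : finType) (e : rel T).
Implicit Types (B C D R S : {set T}) (p : seq {set T}).

Lemma spread_subset C : C \subset spread e C.
Proof. exact: subsetUl. Qed.

Lemma spreadS B C : B \subset C -> spread e B \subset spread e C.
Proof.
move=> /subsetP sBC; apply/subsetP => v; rewrite !inE.
case/orP=> [/sBC -> //|/exists_inP[u /sBC uC uv]].
by apply/orP; right; apply/exists_inP; exists u.
Qed.

Lemma cool_step_spread C D : cool_step e C D -> spread e C \subset D.
Proof.
case/andP=> _; rewrite /select_one.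
case: ifP => _; first by rewrite inE => /eqP ->.
by case/imsetP=> v _ ->; apply: subsetUr.
Qed.

Lemma cool_path_subset C p : path (cool_step e) C p -> C \subset last C p.
Proof.
elim: p C => //= D p IHp C /andP[/cool_step_spread sCD /IHp].
by apply: subset_trans; apply: subset_trans sCD; apply: spread_subset.
Qed.

Lemma cool_path_spread C p :
  path (cool_step e) C p -> 0 < size p -> spread e C \subset last C p.
Proof.
case: p => //= D p /andP[/cool_step_spread sCD /cool_path_subset sD] _.
exact: subset_trans sCD sD.
Qed.

(** [S] collects the vertices chosen along [p]. Each is cooled from its round on, so later choices
    differ from it, and all avoid [spread e C] because cooled sets only grow. *)
Lemma cool_path_chosen C p :
    path (cool_step e) C p -> last C p != setT ->
  exists S, [/\ #|S| = size p, S \subset ~: spread e C & S \subset last C p].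
Proof.
elim: p C => [|D p IHp] C /=; first by exists set0; rewrite cards0 !sub0set.
case/andP=> CD pD lastT; have [S [cS sS sSl]] := IHp D pD lastT.
have sDl := cool_path_subset pD.
case/andP: (CD) => _; rewrite /select_one; case: ifP => [/eqP C0|_].
  (* Only the last round of a full cooling can choose no vertex. *)
  rewrite inE => /eqP DE; case/negP: lastT; rewrite -subTset.
  by rewrite -setC0 -C0 setCK -DE.
case/imsetP=> v; rewrite in_setC => vC DE.
have vD : v \in D by rewrite DE setU11.
have vS : v \notin S.
  apply/negP => /(subsetP sS); rewrite in_setC.
  by rewrite (subsetP (spread_subset D)).
exists (v |: S); split; first by rewrite cardsU1 vS cS.
- rewrite subUset sub1set in_setC vC (subset_trans sS) // setCS.
  exact: subset_trans (cool_step_spread CD) (spread_subset D).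
- by rewrite subUset sub1set (subsetP sDl).
Qed.

(** Induction on [n], matching one burning round with the first [k] steps of [p]. Arbitrary [B] and
    [R] inside [C] make the invariant inductive. *)
Lemma cool_path_rounds_left k n B R C p :
    0 < k -> B \subset C -> R \subset C -> path (cool_step e) C p ->
  rounds_left e k B R <= n -> size p <= k * n.
Proof.
move=> k0; elim: n B R C p => [|n IHn] B R C p sBC sRC pC.
  rewrite leqn0 rounds_left_eq0 => /eqP BT; case: p pC => //= D p.
  by rewrite /cool_step -subTset -BT sBC.
have [le_pk _|lt_kp] := leqP (size p) k.
  by rewrite mulnS (leq_trans le_pk) ?leq_addr.
have BT : B != setT.
  case: p pC lt_kp => //= D p /andP[/andP[CT _] _] _.
  by apply: contraNneq CT => BT; rewrite -subTset -BT.
rewrite rounds_left_leq // => /'forall_implyP le_n.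
have szk : size (take k p) = k by rewrite size_take lt_kp.
move: pC; rewrite -{1}(cat_take_drop k p) cat_path => /andP[pk pd].
(* A further cooling step starts from this set, so it cannot be full. *)
have lastT : last C (take k p) != setT.
  have: 0 < size (drop k p) by rewrite size_drop subn_gt0.
  by case: (drop k p) pd => //= D q /andP[/andP[]].
have [S [cS sS sSl]] := cool_path_chosen pk lastT.
have sCl := cool_path_subset pk.
(* Since [k] is positive, at least one cooling round passes, and its propagation covers that of the
   fire. *)
have sBl : spread e B \subset last C (take k p).
  by apply: subset_trans (spreadS sBC) (cool_path_spread pk _); rewrite szk.
have sRSl : R :|: S \subset last C (take k p).
  by rewrite subUset sSl (subset_trans sRC).
have sSRB : S \subset ~: (R :|: spread e B).
  apply: subset_trans sS _; rewrite setCS subUset spreadS // andbT.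
  exact: subset_trans sRC (spread_subset C).
(* The [k] vertices of [S] are all available, so the minimum in [legal_reveal] is [k]. *)
have SP : legal_reveal k (spread e B) R S.
  rewrite /legal_reveal sSRB; have := subset_leq_card sSRB.
  by rewrite cS szk => /minn_idPl ->; rewrite eqxx.
have /'exists_andP[D [DP Dn]] := le_n S SP.
have sDl : D \subset last C (take k p).
  move: DP; rewrite /select_one; case: ifP => _; first by rewrite inE => /eqP ->.
  case/imsetP=> v; rewrite in_setD => /andP[_ /(subsetP sRSl) vl] ->.
  by rewrite subUset sub1set vl.
have := IHn _ _ _ _ sDl sRSl pd Dn.
by rewrite size_drop mulnS leq_subLR.
Qed.

Lemma cooling_number_leq k :
  0 < k -> cooling_number e <= k * liminal_burning_number e k.
Proof.
move=> k0; have [[p /andP[p0 _] <-] _] := cooling_number_max e.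
by apply: cool_path_rounds_left p0 _; rewrite ?sub0set.
Qed.

End CoolingBoundsBurning.

Import Order.TTheory GRing.Theory Num.Theory.

Theorem theorem12 (T : finType) (e : rel T)
    (e_sym : symmetric e) (e_irr : irreflexive e) (k : nat) (k_gt0 : 0 < k) :
  (Num.ceil ((cooling_number e)%:R / k%:R : rat)
     <= (liminal_burning_number e k)%:Z)%R.
Proof.
rewrite ceil_le_int ler_pdivrMr ?ltr0n //.
(* The integer cast of a natural number is convertible to its [%:R] cast, which brings the goal back
   to [nat]. *)
by rewrite -[X in (_ <= X * _)%R]/(_%:R)%R -natrM ler_nat mulnC cooling_number_leq.
Qed.
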